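(* Let $\mathcal H$ be a real Hilbert space and $\hat H\colon\operatorname{dom}(\hat H)\subset\mathcal H\to\mathcal H$ a densely defined self-adjoint linear operator. Assume that $E_0:=\inf\sigma(\hat H)>-\infty$ is an eigenvalue of $\hat H$ and that $E_1:=\inf(\sigma(\hat H)\setminus\{E_0\})>E_0$. Let $V$ be the eigenspace of $E_0$ and $P_0$ the orthogonal projection onto $V$. Let $\psi_0\in\mathbb S$ with $\psi_0\notin V^\perp$, and let $\psi\colon[0,\infty)\to\mathbb S\cap\operatorname{dom}(\hat H)$ be a solution of the gradient flow \[ \psi'(t)=-2\big[\hat H\psi(t)-E(\psi(t))\psi(t)\big],\qquad \psi(0)=\psi_0, \] where the time derivative is understood classically with values in $\mathcal H$. Set $v_0:=P_0\psi_0/\|P_0\psi_0\|$ and $\alpha:=\|\psi_0-P_0\psi_0\|/\|P_0\psi_0\|$. Then for all $t\ge0$, \[ \|v_0-\psi(t)\|\le\sqrt2\,\alpha\,e^{-2(E_1-E_0)t}. \]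
   Context: $\mathbb S=\{\psi\in\mathcal H:\langle\psi,\psi\rangle=1\}$ is the unit sphere, and for $\psi\in\operatorname{dom}(\hat H)\setminus\{0\}$ the energy (Rayleigh quotient) is $E(\psi)=\langle\psi,\hat H\psi\rangle/\langle\psi,\psi\rangle$. $\sigma(\hat H)$ denotes the spectrum of $\hat H$. *)

(* Defs.v *)
From HB Require Import structures.
From mathcomp Require Import all_boot all_order all_algebra.
From mathcomp Require Import all_classical all_reals all_analysis.
Set Implicit Arguments. Unset Strict Implicit. Unset Printing Implicit Defensive.
Import Order.TTheory GRing.Theory Num.Theory.
Import numFieldNormedType.Exports.
Local Open Scope classical_set_scope.
Local Open Scope ring_scope.

Section Hilbert.
Context {R : realType} {H : completeNormedModType R}.

(* ip is a real inner product on H whose induced norm is the norm of H;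
   since H is complete, (H, ip) is a real Hilbert space. *)
Record is_hilbert_ip (ip : H -> H -> R) : Prop := {
  ip_sym : forall x y, ip x y = ip y x;
  ip_linl : forall (a : R) x y z, ip (a *: x + y) z = a * ip x z + ip y z;
  ip_pos : forall x, x != 0 -> 0 < ip x x;
  ip_norm : forall x, `|x| = Num.sqrt (ip x x) }.

Definition lin_subspace (D : set H) : Prop :=
  D 0 /\ forall (a : R) x y, D x -> D y -> D (a *: x + y).

Definition linear_on (D : set H) (A : H -> H) : Prop :=
  forall (a : R) x y, D x -> D y -> A (a *: x + y) = a *: A x + A y.

(* self-adjointness: dom(A^* ) = D and A^* = A on D.
   (dom(A^* ) = {y | exists z, forall x in D, <Ax,y> = <x,z>}, A^* y = z.) *)
Definition self_adjoint (ip : H -> H -> R) (D : set H) (A : H -> H) : Prop :=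
  (forall y, D y <-> exists z, forall x, D x -> ip (A x) y = ip x z) /\
  (forall x y, D x -> D y -> ip (A x) y = ip x (A y)).

Definition resolvent (D : set H) (A : H -> H) (lam : R) : Prop :=
  (forall y, exists x, D x /\ A x - lam *: x = y) /\
  (forall x1 x2, D x1 -> D x2 -> A x1 - lam *: x1 = A x2 - lam *: x2 -> x1 = x2) /\
  (exists C : R, forall x, D x -> `|x| <= C * `|A x - lam *: x|).

Definition spec (D : set H) (A : H -> H) : set R :=
  [set lam | ~ resolvent D A lam].

Definition eigsp (D : set H) (A : H -> H) (lam : R) : set H :=
  [set x | D x /\ A x = lam *: x].

Definition is_eigenvalue (D : set H) (A : H -> H) (lam : R) : Prop :=
  exists x, D x /\ x != 0 /\ A x = lam *: x.

Definition orth (ip : H -> H -> R) (V : set H) : set H :=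
  [set x | forall v, V v -> ip x v = 0].

Definition orth_proj (ip : H -> H -> R) (V : set H) (P : H -> H) : Prop :=
  forall x, V (P x) /\ orth ip V (x - P x).

Definition unit_sphere (ip : H -> H -> R) : set H := [set x | ip x x = 1].

Definition energy (ip : H -> H -> R) (A : H -> H) (x : H) : R :=
  ip x (A x) / ip x x.

(* d is the classical derivative of psi at t, relative to the domain [0,oo)
   (i.e. one-sided at t = 0). *)
Definition halfline_derivative (psi : R -> H) (t : R) (d : H) : Prop :=
  (fun h : R => h^-1 *: (psi (t + h) - psi t))
     @ within [set h | 0 <= t + h] (0 : R)^' --> d.

Definition dense_in (D : set H) : Prop :=
  mathcomp.analysis.topology_theory.topology_structure.dense D.

End Hilbert.

(* Main.v *)
Require Import Defs.
From HB Require Import structures.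
From mathcomp Require Import all_boot all_order all_algebra.
From mathcomp Require Import all_classical all_reals all_analysis.
From mathcomp Require Import ring lra.
Import Order.TTheory GRing.Theory Num.Theory.
Import numFieldNormedType.Exports.
Local Open Scope classical_set_scope.
Local Open Scope ring_scope.

(* The eigenspace V of E0 is preserved by the flow up to scaling, so P0 psi(t) =
   c(t) v0 with c' = 2 (E(psi) - E0) c, and 1/c^2 - 1 is the squared tangent of the
   angle between psi(t) and V.  The spectral gap on the complement of V gives
   E(psi) - E0 >= (E1 - E0) (1 - c^2), hence
   (1/c^2 - 1)' <= -4 (E1 - E0) (1/c^2 - 1), and
   |v0 - psi|^2 = 2 (1 - c) <= 2 (1/c^2 - 1).

   The gap is obtained without the spectral theorem.  Put B = A - E0 and
   g = E1 - E0.  For a self-adjoint operator |(A - c) x| >= dist(c, spec) |x|;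
   letting c -> -oo gives B >= 0, and the midpoint c of E0 and E1 gives
   B^2 >= g B.  Positivity of B at x - B x / g turns this into
   <B y, y> >= g |y|^2 for y in the range of B, which is dense in the
   complement of V. *)

(** * Real inner products: bilinearity, Cauchy-Schwarz, continuity, density *)

Section InnerProduct.
Context {R : realType} {H : completeNormedModType R} {ip : H -> H -> R}.
Context (hip : is_hilbert_ip ip).

Lemma ipC x y : ip x y = ip y x. Proof. exact: ip_sym. Qed.

Lemma ipDl x y z : ip (x + y) z = ip x z + ip y z.
Proof. by rewrite -[x]scale1r (ip_linl hip) mul1r scale1r. Qed.

Lemma ip0l z : ip 0 z = 0.
Proof. by apply: (@addrI _ (ip 0 z)); rewrite -ipDl !addr0. Qed.

Lemma ipZl a x z : ip (a *: x) z = a * ip x z.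
Proof. by rewrite -[a *: x]addr0 (ip_linl hip) ip0l addr0. Qed.

Lemma ipNl x z : ip (- x) z = - ip x z.
Proof. by rewrite -scaleN1r ipZl mulN1r. Qed.

Lemma ipBl x y z : ip (x - y) z = ip x z - ip y z.
Proof. by rewrite ipDl ipNl. Qed.

Lemma ipDr x y z : ip x (y + z) = ip x y + ip x z.
Proof. by rewrite ipC ipDl ![ip _ x]ipC. Qed.

Lemma ip0r x : ip x 0 = 0.
Proof. by rewrite ipC ip0l. Qed.

Lemma ipZr a x y : ip x (a *: y) = a * ip x y.
Proof. by rewrite ipC ipZl ipC. Qed.

Lemma ipNr x y : ip x (- y) = - ip x y.
Proof. by rewrite ipC ipNl ipC. Qed.

Lemma ipBr x y z : ip x (y - z) = ip x y - ip x z.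
Proof. by rewrite ipDr ipNr. Qed.

Definition ipE := (ipBl, ipBr, ipDl, ipDr, ipNl, ipNr, ipZl, ipZr).

Lemma ip_ge0 x : 0 <= ip x x.
Proof. by have [->|/(ip_pos hip)/ltW//] := eqVneq x 0; rewrite ip0l. Qed.

Lemma ipxx x : ip x x = `|x| ^+ 2.
Proof. by rewrite (ip_norm hip) sqr_sqrtr ?ip_ge0. Qed.

Lemma ip_eq0 x : ip x x = 0 -> x = 0.
Proof. by rewrite ipxx => /eqP; rewrite sqrf_eq0 normr_eq0 => /eqP. Qed.

Lemma cauchy_schwarz x y : `|ip x y| <= `|x| * `|y|.
Proof.
have [->|y0] := eqVneq y 0; first by rewrite ip0r normr0 normr0 mulr0.
have Y : 0 < `|y| by rewrite normr_gt0.
rewrite -ler_sqr ?nnegrE ?mulr_ge0// exprMn -!ipxx.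
have P : 0 < ip y y by exact: ip_pos.
have := ip_ge0 (ip y y *: x - ip x y *: y).
rewrite !ipE (ipC y x) => h.
have {}h : 0 <= ip y y * (ip x x * ip y y - ip x y ^+ 2) by lra.
by rewrite -(ler_pM2l P) real_normK ?num_real//; lra.
Qed.

Lemma ip_continuous x : continuous (ip x).
Proof.
move=> y; apply/cvgrPdist_le => e e0.
have K : 0 < `|x| + 1 by rewrite ltr_wpDl.
near=> z.
rewrite -ipBr (le_trans (cauchy_schwarz _ _))//.
apply: (@le_trans _ _ ((`|x| + 1) * `|y - z|)).
  by rewrite ler_wpM2r// lerDl.
rewrite -ler_pdivlMl// mulrC.
near: z; apply: cvgr_dist_le; first exact: cvg_id.
by rewrite divr_gt0.
Unshelve. all: by end_near.
Qed.

(** If [x] were nonzero, some [z] in [D] would satisfy [|x - z| < |x|], whereas orthogonality gives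
    [|x - z|^2 = |x|^2 + |z|^2]. *)
Lemma orth_dense_eq0 {D : set H} {x : H} : dense_in D ->
  (forall z, D z -> ip z x = 0) -> x = 0.
Proof.
move=> dD hx; apply: contrapT => /eqP x0.
have N : 0 < `|x| by rewrite normr_gt0.
have [|z [bz /hx zx]] := dD (ball x `|x|) _ (ball_open x `|x|).
  by exists x; exact: ballxx.
move: bz; rewrite -ball_normE/= -ltr_sqr ?nnegrE// -!ipxx !ipE (ipC x z) zx.
by have := ip_ge0 z; lra.
Qed.

End InnerProduct.

(* Locked, so that rewriting with [ipE] leaves [ip (opshift A c x) y] alone. *)
Definition opshift {R : realType} {H : completeNormedModType R} (A : H -> H)
    (c : R) (x : H) : H := locked (A x - c *: x).

Lemma shiftE {R : realType} {H : completeNormedModType R} (A : H -> H) c x :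
  opshift A c x = A x - c *: x.
Proof. by rewrite /opshift -lock. Qed.

(** * Self-adjoint operators: distance to the spectrum and form inequalities *)

Section SelfAdjoint.
Context {R : realType} {H : completeNormedModType R} {ip : H -> H -> R}.
Context (hip : is_hilbert_ip ip).
Context {D : set H} {A : H -> H}.
Context (sD : lin_subspace D) (lA : linear_on D A) (sA : self_adjoint ip D A).

Local Notation shift := (opshift A).

Lemma dom_lin a x y : D x -> D y -> D (a *: x + y).
Proof. by case: sD => _; exact. Qed.

Lemma domZ a x : D x -> D (a *: x).
Proof. by move=> Dx; rewrite -[a *: x]addr0; apply: dom_lin => //; case: sD. Qed.

Lemma domB x y : D x -> D y -> D (x - y).
Proof. by move=> Dx Dy; rewrite addrC -scaleN1r; exact: dom_lin. Qed.

Lemma shift_lin c a x y : D x -> D y ->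
  shift c (a *: x + y) = a *: shift c x + shift c y.
Proof.
by move=> Dx Dy; rewrite !shiftE lA// scalerBr scalerDr !scalerA mulrC opprD addrACA.
Qed.

Lemma shiftZ c a x : D x -> shift c (a *: x) = a *: shift c x.
Proof.
move=> Dx; have := shift_lin c a _ _ Dx (proj1 sD).
rewrite addr0 => ->; have := shift_lin c 1 _ _ (proj1 sD) (proj1 sD).
rewrite !scale1r addr0 => /eqP; rewrite -subr_eq0 opprD addrA subrr sub0r oppr_eq0.
by move=> /eqP ->; rewrite addr0.
Qed.

Lemma shiftB c x y : D x -> D y -> shift c (x - y) = shift c x - shift c y.
Proof.
move=> Dx Dy; have := shift_lin c (-1) _ _ Dy Dx.
by rewrite !scaleN1r addrC => ->; rewrite addrC.
Qed.

Lemma shift_shift c m x : shift (c + m) x = shift c x - m *: x.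
Proof. by rewrite !shiftE scalerDl opprD addrA. Qed.

Lemma shift_sym c x y : D x -> D y -> ip (shift c x) y = ip x (shift c y).
Proof. by move=> Dx Dy; rewrite !shiftE !(ipE hip) (proj2 sA). Qed.

Lemma resolvent_bound l : resolvent D A l ->
  exists2 C : R, 0 <= C & forall x, D x -> `|x| <= C * `|shift l x|.
Proof.
move=> [_ [_ [C hC]]]; exists `|C| => // x Dx.
by rewrite shiftE (le_trans (hC _ Dx))// ler_wpM2r// ler_norm.
Qed.

Lemma resolvent_surj l : resolvent D A l ->
  forall y, exists2 x, D x & shift l x = y.
Proof. by move=> [h _] y; have [x [Dx <-]] := h y; exists x; rewrite ?shiftE. Qed.

(* Take the best constant m in m |x| <= |(A - c) x|.  If x almost attains it and
   (A - c) z = x, then ((A - c)^2 - m^2) z is small, so one of c + m, c - m is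
   in the spectrum. *)
Lemma dist_spec_le c r : (forall l, `|l - c| < r -> resolvent D A l) ->
  forall x, D x -> r * `|x| <= `|shift c x|.
Proof.
move=> res x1 Dx1; rewrite leNgt; apply/negP => lt1.
have x10 : 0 < `|x1|.
  rewrite lt_neqAle normr_ge0 andbT; apply: contraTN lt1 => /eqP <-.
  by rewrite mulr0 -leNgt.
pose K := [set k : R | forall x, D x -> k * `|x| <= `|shift c x|].
have K0 : K 0 by move=> x _; rewrite mul0r.
have Kub x : D x -> 0 < `|x| -> ubound K (`|shift c x| / `|x|).
  by move=> Dx xp k Kk; rewrite ler_pdivlMr//; exact: Kk.
have supK : has_sup K by split; [exists 0|exists (`|shift c x1| / `|x1|); exact: Kub].
pose m := sup K.
have m0 : 0 <= m by exact: (ub_le_sup (proj2 supK)).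
have mr : m < r.
  apply: (@le_lt_trans _ _ (`|shift c x1| / `|x1|)).
    by apply: ge_sup; [exists 0|exact: Kub].
  by rewrite ltr_pdivrMr.
have Km x : D x -> m * `|x| <= `|shift c x|.
  move=> Dx; have [->|x0] := eqVneq `|x| 0; first by rewrite mulr0.
  have xp : 0 < `|x| by rewrite lt_neqAle eq_sym x0 normr_ge0.
  by rewrite -ler_pdivlMr//; apply: ge_sup; [exists 0|exact: Kub].
have sc : forall y, exists2 x, D x & shift c x = y.
  by apply/resolvent_surj/res; rewrite subrr normr0 (le_lt_trans m0).
have [C1 C10 h1] : exists2 C : R, 0 <= C & forall x, D x -> `|x| <= C * `|shift (c + m) x|.
  by apply/resolvent_bound/res; rewrite addrC addKr ger0_norm.
have [C2 C20 h2] : exists2 C : R, 0 <= C & forall x, D x -> `|x| <= C * `|shift (c + - m) x|.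
  by apply/resolvent_bound/res; rewrite addrC addKr normrN ger0_norm.
(* [L] collects the constants of the final chain [|x|^2 <= L * e * |x|^2]; [e] is chosen so that
   [L * e < 1] makes this absurd. *)
pose L := (m + 1) ^+ 2 * (C2 * C1) ^+ 2 * (2 * m + 1).
have L0 : 0 <= L by rewrite !mulr_ge0 ?exprn_ge0 ?mulr_ge0 ?addr_ge0 ?mulr_ge0.
pose e := (L + 1)^-1.
have e0 : 0 < e by rewrite invr_gt0 ltr_wpDl.
have e1 : e <= 1 by rewrite invf_le1 ?lerDr// ltr_wpDl.
have Le : L * e < 1 by rewrite ltr_pdivrMr ?ltr_wpDl// mul1r ltrDl.
have [x [Dx ltx]] : exists x, D x /\ `|shift c x| < (m + e) * `|x|.
  apply: contrapT => /forallNP nx.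
  suff : m + e <= m by rewrite gerDl leNgt e0.
  apply: (ub_le_sup (proj2 supK)) => x Dx.
  by rewrite leNgt; apply/negP => ?; apply: (nx x).
have [z Dz Tz] := sc x.
(* With [T = A - c] and [T z = x], [w = (T^2 - m^2) z]. It factors through [m z + x = (T + m) z], on
   which [T - m] gives [w]; the two resolvent bounds then control [|z|] by [|w|]. *)
pose w := shift c x - m ^+ 2 *: z.
have zy : `|z| <= C2 * `|m *: z + x|.
  by rewrite (le_trans (h2 _ Dz))// shift_shift Tz scaleNr opprK addrC.
have yw : `|m *: z + x| <= C1 * `|w|.
  rewrite (le_trans (h1 _ (dom_lin m _ _ Dz Dx)))// shift_shift shift_lin// Tz.
  by rewrite scalerDr scalerA -expr2 [_ *: x + _]addrC [_ *: z + _]addrC addrKA.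
have Txz : ip (shift c x) z = `|x| ^+ 2 by rewrite shift_sym// Tz (ipxx hip).
(* Since [<T x, z> = |x|^2], expansion gives [|w|^2 = |T x|^2 - 2 m^2 |x|^2 + m^4 |z|^2]. The bounds
   [|T x| <= (m + e) |x|] and [m |z| <= |x|] leave [(2 m e + e^2) |x|^2], and [e <= 1]. *)
have w2 : `|w| ^+ 2 <= (2 * m + 1) * e * `|x| ^+ 2.
  have := Km _ Dz; rewrite Tz => mz.
  have mz2 : (m * `|z|) ^+ 2 <= `|x| ^+ 2 by rewrite ler_sqr ?nnegrE ?mulr_ge0.
  have tx2 : `|shift c x| ^+ 2 <= ((m + e) * `|x|) ^+ 2.
    by rewrite ler_sqr ?nnegrE ?mulr_ge0 ?addr_ge0// ltW.
  rewrite -(ipxx hip) /w !(ipE hip) (ipC hip z (shift c x)) Txz !(ipxx hip).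
  have : m ^+ 2 * (m * `|z|) ^+ 2 <= m ^+ 2 * `|x| ^+ 2.
    by rewrite ler_wpM2l ?exprn_ge0.
  have : e * (e * `|x| ^+ 2) <= 1 * (e * `|x| ^+ 2).
    by rewrite ler_wpM2r ?mulr_ge0// ?exprn_ge0// ltW.
  move: mz2 tx2; rewrite !exprMn sqrrD; lra.
(* Cauchy-Schwarz on [|x|^2 = <T x, z>], with [|T x| <= (m + 1) |x|]. *)
have xz : `|x| <= (m + 1) * `|z|.
  have [->|x0] := eqVneq `|x| 0; first by rewrite mulr_ge0 ?addr_ge0.
  have xp : 0 < `|x| by rewrite lt_neqAle eq_sym x0 normr_ge0.
  rewrite -(ler_pM2l xp) -expr2 -Txz (le_trans (ler_norm _))//.
  rewrite (le_trans (cauchy_schwarz hip _ _))// mulrA ler_wpM2r//.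
  rewrite (le_trans (ltW ltx))// mulrC ler_wpM2l// lerD2l//.
have xw : `|x| <= (m + 1) * (C2 * C1) * `|w|.
  rewrite (le_trans xz)// -mulrA ler_wpM2l ?addr_ge0// (le_trans zy)// -mulrA.
  by rewrite ler_wpM2l.
have xp : 0 < `|x|.
  rewrite lt_neqAle normr_ge0 andbT; apply: contraTN ltx => /eqP <-.
  by rewrite mulr0 -leNgt.
have : `|x| ^+ 2 <= ((m + 1) * (C2 * C1) * `|w|) ^+ 2.
  by rewrite ler_sqr ?nnegrE ?mulr_ge0 ?addr_ge0.
rewrite 2!exprMn => hx.
have : `|x| ^+ 2 <= L * e * `|x| ^+ 2.
  rewrite (le_trans hx)// /L.
  have -> : (m + 1) ^+ 2 * (C2 * C1) ^+ 2 * (2 * m + 1) * e * `|x| ^+ 2 =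
      (m + 1) ^+ 2 * (C2 * C1) ^+ 2 * ((2 * m + 1) * e * `|x| ^+ 2) by ring.
  by rewrite ler_wpM2l ?mulr_ge0 ?exprn_ge0 ?addr_ge0 ?mulr_ge0.
by rewrite ler_pMl ?exprn_gt0// leNgt Le.
Qed.

(** The point [E0 - s] is at distance at least [s] from the spectrum; squaring
    [s |x| <= |(B + s) x|] gives [0 <= |B x|^2 + 2 s <B x, x>] for every [s > 0]. *)
Lemma form_ge0 E0 : (forall l, l < E0 -> resolvent D A l) ->
  forall x, D x -> 0 <= ip (shift E0 x) x.
Proof.
move=> res x Dx; rewrite leNgt; apply/negP => neg.
set b := ip _ _ in neg; pose N := ip (shift E0 x) (shift E0 x).
have N0 : 0 <= N by exact: (ip_ge0 hip).
(* This choice turns [N + 2 * s * b] into [-1]. *)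
pose s := (N + 1) / (- 2 * b).
have s0 : 0 < s by rewrite divr_gt0 ?ltr_wpDl// mulNr oppr_gt0 pmulr_rlt0.
have sb : 2 * s * b = - (N + 1) by rewrite /s; field; rewrite lt_eqF.
have h : s * `|x| <= `|shift (E0 - s) x|.
  by apply: dist_spec_le => // l; rewrite ltr_norml => /andP[_ ?]; apply: res; lra.
have : (s * `|x|) ^+ 2 <= `|shift (E0 - s) x| ^+ 2.
  by rewrite ler_sqr ?nnegrE// mulr_ge0// ltW.
rewrite exprMn -!(ipxx hip) shift_shift !(ipE hip) -/b -/N (ipC hip x (shift E0 x)) -/b.
lra.
Qed.

(** The midpoint of the gap is at distance at least [s], half its length, from the spectrum.
    Squaring [s |x| <= |(B - s) x|] cancels [s^2 |x|^2] and leaves [2 s <B x, x> <= |B x|^2]. *)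
Lemma form_sqr_ge E0 E1 : E0 < E1 ->
  (forall l, E0 < l < E1 -> resolvent D A l) ->
  forall x, D x ->
    (E1 - E0) * ip (shift E0 x) x <= ip (shift E0 x) (shift E0 x).
Proof.
move=> E01 res x Dx; pose s := (E1 - E0) / 2.
have s0 : 0 < s by rewrite divr_gt0 ?subr_gt0.
have h : s * `|x| <= `|shift (E0 + s) x|.
  apply: dist_spec_le => // l; rewrite ltr_norml => /andP[h1 h2]; apply: res.
  by apply/andP; split; rewrite /s in h1 h2; lra.
have : (s * `|x|) ^+ 2 <= `|shift (E0 + s) x| ^+ 2.
  by rewrite ler_sqr ?nnegrE// mulr_ge0// ltW.
rewrite exprMn -!(ipxx hip) shift_shift !(ipE hip) (ipC hip x (shift E0 x)).
have -> : E1 - E0 = 2 * s by rewrite /s; field.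
lra.
Qed.

End SelfAdjoint.

(** * Spectral gap on the orthogonal complement of the eigenspace *)

Lemma cauchy_harmonic_cvg {R : realType} {H : completeNormedModType R}
    (u : nat -> H) (K : R) :
  (forall n m, `|u n - u m| <= K * (harmonic n + harmonic m)) ->
  cvg (u @ \oo).
Proof.
move=> hu; apply/cauchy_cvgP/cauchy_exP => _/posnumP[e].
have Kh : (fun n => `|K| * harmonic n) @ \oo --> (0 : R).
  by rewrite -[X in _ --> X](mulr0 `|K|); apply: cvgMr; exact: cvg_harmonic.
have [N _ small] : \forall n \near \oo, `|K| * harmonic n < e%:num / 2.
  exact: cvgr_lt Kh _ _.
exists (u N); exists N => // n Nn /=.
rewrite -ball_normE/= (le_lt_trans (hu N n))//.
rewrite (@le_lt_trans _ _ (`|K| * (harmonic N + harmonic n)))//.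
  by rewrite ler_wpM2r ?ler_norm// addr_ge0// ltW// harmonic_gt0.
by rewrite mulrDr [e%:num]splitr ltrD// small//= leqnn.
Qed.

Section Gap.
Context {R : realType} {H : completeNormedModType R} {ip : H -> H -> R}.
Context (hip : is_hilbert_ip ip).
Context {D : set H} {A : H -> H}.
Context (sD : lin_subspace D) (lA : linear_on D A) (sA : self_adjoint ip D A).

Local Notation shift := (opshift A).

(** Closedness of the graph via the adjoint: in the limit [v] is orthogonal to the range of [A - l],
    so [<A z, v> = <z, l v>] on [D]. This puts [v] in the domain of the adjoint, which is [D]. *)
Lemma cvg_eigsp l (u : nat -> H) (v : H) : dense_in D -> (forall n, D (u n)) ->
  u @ \oo --> v -> (fun n => shift l (u n)) @ \oo --> 0 -> eigsp D A l v.
Proof.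
move=> dD Du uv su0.
have z0 z : D z -> ip (shift l z) v = 0.
  move=> Dz; apply: (@cvg_unique _ (@Rhausdorff R) (ip (shift l z) (u n) @[n --> \oo])).
    by apply: continuous_cvg uv; exact: ip_continuous.
  rewrite (_ : (fun n => _) = fun n => ip z (shift l (u n))); last first.
    by apply/funext => n; rewrite (shift_sym hip sA).
  by rewrite -(ip0r hip z); apply: continuous_cvg su0; exact: ip_continuous.
have Dv : D v.
  apply/(proj1 sA); exists (l *: v) => z Dz; apply/eqP.
  by rewrite (ipZr hip) -subr_eq0 -(ipZl hip) -(ipBl hip) -shiftE z0.
split=> //; apply/eqP; rewrite -subr_eq0; apply/eqP.
apply: (orth_dense_eq0 hip dD) => z Dz.
by rewrite -shiftE -(shift_sym hip sA)// z0.
Qed.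

Context {E0 E1 : R}.
Context (E01 : E0 < E1) (resl : forall l, l < E0 -> resolvent D A l).
Context (resr : forall l, E0 < l < E1 -> resolvent D A l).
Let g := E1 - E0.
Let B := shift E0.

(** Positivity at [x - g^-1 B x] expands to [0 <= <B x, x> - 2 g^-1 |B x|^2 + g^-2 <B B x, B x>];
    then [<B x, x> <= g^-1 |B x|^2] is inserted. *)
Lemma gap_on_range x : D x -> D (B x) -> g * ip (B x) (B x) <= ip (B (B x)) (B x).
Proof.
move=> Dx DBx; have g0 : 0 < g by rewrite subr_gt0.
have := form_ge0 hip sD lA sA _ resl (x - g^-1 *: B x) (domB sD _ _ Dx (domZ sD _ _ DBx)).
have := form_sqr_ge hip sD lA sA _ _ E01 resr x Dx.
rewrite (shiftB lA)//; last exact: domZ.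
rewrite (shiftZ sD lA)// -/B -/g !(ipE hip) (shift_sym hip sA _ _ _ DBx Dx) -/B => h1 h2.
have gi : g * g^-1 = 1 by rewrite divff// gt_eqF.
have i0 : 0 < g^-1 by rewrite invr_gt0.
move: h1 h2 gi i0; move: (g^-1) => i h1 h2 gi i0.
set a := ip (B x) x in h1 h2; set Y := ip (B x) (B x) in h1 h2 *.
set Z := ip (B (B x)) (B x) in h2 *.
have : i * (g * a) <= i * Y by rewrite ler_pM2l.
rewrite mulrA [i * g]mulrC gi mul1r => h3.
have : g * (g * (i * Y)) <= g * (g * (i * (i * Z))) by rewrite 2?ler_pM2l//; lra.
by rewrite [g * (i * Y)]mulrA [g * (i * _)]mulrA gi !mul1r [g * (i * _)]mulrA gi mul1r.
Qed.

(* Density of the range of B in the orthogonal complement of its kernel: the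
   vectors e (B + e)^-1 x = x - B (B + e)^-1 x are Cauchy as e -> 0 since the gap
   holds on the range, and their limit lies in the kernel. *)
Lemma spectral_gap x : dense_in D -> D x -> orth ip (eigsp D A E0) x ->
  g * ip x x <= ip (B x) x.
Proof.
move=> dD Dx Vx; have g0 : 0 < g by rewrite subr_gt0.
have hh n : 0 < harmonic n :> R by exact: harmonic_gt0.
have /choice[y hy] n : exists z, D z /\ B z + harmonic n *: z = x.
  have [|z Dz hz] := @resolvent_surj _ _ D A (E0 - harmonic n) _ x.
    by apply: resl; rewrite ltrBlDr ltrDl.
  by exists z; split=> //; rewrite -hz (shift_shift (A := A)) scaleNr opprK.
pose u n := harmonic n *: y n.
have Dy n : D (y n) by case: (hy n).
have Du n : D (u n) by exact: (domZ sD).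
have By n : B (y n) = x - u n by case: (hy n) => _ <-; rewrite addrK.
have Bu n : B (u n) = harmonic n *: (x - u n) by rewrite /B /u (shiftZ sD lA)// -/B By.
clearbody u.
have uu n : ip (u n) (u n) <= ip x (u n).
  have := form_ge0 hip sD lA sA _ resl _ (Du n).
  by rewrite -/B Bu (ipZl hip) pmulr_rge0// (ipBl hip) subr_ge0.
(* Both norm bounds follow from [|u n|^2 <= <x, u n>], that is, from positivity of [B] at [u n]. *)
have xu n : `|x - u n| <= `|x|.
  rewrite -ler_sqr ?nnegrE// -!(ipxx hip) !(ipE hip) (ipC hip (u n) x).
  by have := uu n; have := ip_ge0 hip (u n); lra.
have nu n : `|u n| <= `|x|.
  rewrite -ler_sqr ?nnegrE// -!(ipxx hip).
  by have := uu n; have := ip_ge0 hip (x - u n); rewrite !(ipE hip) (ipC hip (u n) x); lra.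
have nBu n : `|B (u n)| <= harmonic n * `|x|.
  by rewrite Bu normrZ gtr0_norm// ler_pM2l.
(* The difference [d = u n - u m] lies in the range of [B], so [g |d|^2 <= |B d| |d|], and
   [|B d| <= |B (u n)| + |B (u m)|]. *)
have du n m : `|u n - u m| <= g^-1 * `|x| * (harmonic n + harmonic m).
  have dE : u n - u m = B (y m - y n).
    by rewrite {1}/B (shiftB lA)// -/B !By opprB [RHS]addrC addrA subrK.
  have Dd : D (u n - u m) by exact: (domB sD).
  have := gap_on_range (y m - y n) (domB sD _ _ (Dy m) (Dy n)).
  rewrite -dE => /(_ Dd) h.
  have [->|d0] := eqVneq (u n - u m) 0.
    rewrite normr0 mulr_ge0// ?mulr_ge0 ?invr_ge0//; first exact: ltW.
    by apply: addr_ge0; exact: ltW.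
  have dp : 0 < `|u n - u m| by rewrite normr_gt0.
  rewrite -mulrA ler_pdivlMl// -(ler_pM2r dp) -mulrA -expr2 -(ipxx hip).
  rewrite (le_trans h)// (le_trans (ler_norm _))//.
  rewrite (le_trans (cauchy_schwarz hip _ _))// ler_wpM2r//.
  rewrite {1}/B (shiftB lA)// (le_trans (ler_normB _ _))//.
  by rewrite mulrC mulrDl lerD.
have /cvg_ex[v uv] := cauchy_harmonic_cvg _ _ du.
have Kh K : (fun n => K * harmonic n) @ \oo --> (0 : R).
  by rewrite -[X in _ --> X](mulr0 K); apply: cvgMr; exact: cvg_harmonic.
have Bu0 : (fun n => B (u n)) @ \oo --> 0.
  apply: norm_cvg0; apply: (@squeeze_cvgr _ _ _ _ (cst 0) (fun n => `|x| * harmonic n)).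
  - by apply: nearW => n; rewrite normr_ge0 mulrC nBu.
  - exact: cvg_cst.
  - exact: Kh.
have Vv : eigsp D A E0 v by exact: (cvg_eigsp _ _ _ dD Du uv Bu0).
have Bv : B v = 0 by case: Vv => _ Av; rewrite /B shiftE Av subrr.
(* Both [x] and [x - u n = B (y n)] are orthogonal to the kernel vector [v]; hence so is [u n],
   which forces the limit [v] to vanish. *)
have uv0 n : ip v (u n) = 0.
  have : ip (x - u n) v = 0 by rewrite -By (shift_sym hip sA)//;
      [rewrite -/B Bv (ip0r hip)|case: Vv].
  by rewrite (ipBl hip) Vx// sub0r (ipC hip) => /eqP; rewrite oppr_eq0 => /eqP.
have v0 : v = 0.
  apply: (ip_eq0 hip); apply: (@cvg_unique _ (@Rhausdorff R) (ip v (u n) @[n --> \oo])).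
    by apply: continuous_cvg uv; exact: ip_continuous.
  by rewrite (_ : (fun n => _) = cst 0); [exact: cvg_cst|apply/funext].
rewrite {}v0 in uv.
have cu z : ip z (u n) @[n --> \oo] --> (0 : R).
  by rewrite -(ip0r hip z); apply: continuous_cvg uv; exact: ip_continuous.
rewrite -subr_ge0.
(* Expanding the gap inequality at [x - u n] shows that [f n] bounds [<B x, x> - g <x, x>] from
   below, once [<B (u n), u n>] is estimated and [g |u n|^2 >= 0] dropped. *)
pose f n := 2 * ip (B x) (u n) - 2 * g * ip x (u n) - `|x| ^+ 2 * harmonic n.
have f0 : f @ \oo --> (0 : R).
  rewrite (_ : 0 = 2 * 0 - 2 * g * 0 - 0); last by rewrite !mulr0 !subr0.
  by apply: cvgB; [apply: cvgB; apply: cvgMr|].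
apply: (cvgr_to_le f0); apply: nearW => n.
have := gap_on_range (y n) (Dy n); rewrite By => /(_ (domB sD _ _ Dx (Du n))).
rewrite {1 2}/B (shiftB lA)// -/B !(ipE hip) (ipC hip (u n) x).
rewrite (shift_sym hip sA _ _ _ (Du n) Dx) -/B (ipC hip (u n) (B x)) -!/g.
have : ip (B (u n)) (u n) <= `|x| ^+ 2 * harmonic n.
  rewrite (le_trans (ler_norm _))// (le_trans (cauchy_schwarz hip _ _))//.
  by rewrite expr2 mulrAC ler_pM// mulrC.
have := mulr_ge0 (ltW g0) (ip_ge0 hip (u n)).
rewrite /f; lra.
Qed.

End Gap.

(** * Scalar differential inequalities on the half-line *)

Section HalfLine.
Context {R : realType}.

Lemma is_derive_nincry (f df : R -> R) :
  (forall t : R, 0 < t -> is_derive t 1 f (df t)) ->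
  (forall t : R, 0 < t -> df t <= 0) -> f t @[t --> 0^'+] --> f 0 ->
  forall s t : R, 0 <= s -> s <= t -> f t <= f s.
Proof.
move=> fdf df0 f0; apply: ler0_derive1_nincry.
- by move=> t; rewrite in_itv/= andbT => /fdf[].
- move=> t; rewrite in_itv/= andbT => t0.
  by rewrite derive1E (@derive_val _ _ _ _ _ _ _ (fdf _ t0)) df0.
- apply/continuous_within_itvcyP; split=> // t; rewrite in_itv/= andbT => /fdf[dt _].
  exact/differentiable_continuous/derivable1_diffP.
Qed.

Context {c k : R -> R}.
Context (dc : forall t : R, 0 < t -> is_derive t 1 c (k t * c t)).
Context (c0r : c t @[t --> 0^'+] --> c 0).

(** Since [(c^2)' = 2 k c^2 >= 0], [c^2] never falls below [c 0 ^+ 2], so [c] has no zero and cannot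
    change sign. *)
Lemma linear_ode_gt0 : 0 < c 0 -> (forall t : R, 0 < t -> 0 <= k t) ->
  forall t : R, 0 <= t -> 0 < c t.
Proof.
move=> c0 k0.
have mono t : 0 <= t -> c 0 ^+ 2 <= c t ^+ 2.
  move=> t0; rewrite -lerN2.
  apply: (@is_derive_nincry (fun t => - (c t ^+ 2)) (fun t => - (2 * k t * c t ^+ 2))) => //.
  - move=> s /dc dcs; apply: (is_derive_eq (is_deriveN (is_deriveX 2 dcs))).
    by rewrite /GRing.scale/= expr1; ring.
  - by move=> s /k0 ks; rewrite oppr_le0 mulr_ge0 ?sqr_ge0// mulr_ge0.
  - by apply: cvgN; rewrite expr2; under eq_fun do rewrite expr2; exact: cvgM.
move=> t t0; rewrite ltNge; apply/negP => ct.
have [s /andP[s0 _] cs] : exists2 s, s \in `[0, t] & c s = 0.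
  apply: IVT => //.
    have [<-|tp] := eqVneq 0 t; first by rewrite set_itv1; exact: continuous_subspace1.
    have {}tp : 0 < t by rewrite lt_neqAle tp.
    have dcont s : 0 < s -> {for s, continuous c}.
      by move=> /dc[ds _]; exact/differentiable_continuous/derivable1_diffP.
    apply/continuous_within_itvP => //; split=> //.
      by move=> s; rewrite in_itv/= => /andP[s0 _]; exact: dcont.
    exact/cvg_at_left_filter/dcont.
  by rewrite ge_min le_max ct (ltW c0) orbT.
have := mono s s0; rewrite cs expr0n/= leNgt exprn_gt0//.
Qed.

Context (cp : forall t : R, 0 <= t -> 0 < c t).

(** Two solutions of the same linear equation have a quotient of zero derivative. *)
Lemma linear_ode_ratio (f : R -> R) :
  (forall t : R, 0 < t -> is_derive t 1 f (k t * f t)) ->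
  f t @[t --> 0^'+] --> f 0 ->
  forall t : R, 0 <= t -> f t / c t <= f 0 / c 0.
Proof.
move=> df f0r t t0; apply: (@is_derive_nincry (fun t => f t * (c t)^-1) (cst 0)) => //.
- move=> s s0; have cs := cp s (ltW s0); have cn : c s != 0 by rewrite gt_eqF.
  have dV := is_deriveV cn (dc s s0); have dfs := df s s0.
  by apply: (is_derive_eq (is_deriveM dfs dV)); rewrite /GRing.scale/=; field.
- by apply: cvgM => //; apply: cvgV => //; rewrite gt_eqF ?cp.
Qed.

(** For [y = c^-2 - 1], [y' = -2 k c^-2 <= -K (1 - c^2) c^-2 = -K y]; [expR (K * t)] is the
    integrating factor. *)
Lemma bernoulli_decay (K : R) :
  (forall t : R, 0 < t -> K * (1 - c t ^+ 2) <= 2 * k t) ->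
  forall t : R, 0 <= t ->
    (c t ^- 2 - 1) * expR (K * t) <= c 0 ^- 2 - 1.
Proof.
move=> hk t t0.
pose f s := (c s)^-1 * (c s)^-1 - 1.
have fE s : c s ^- 2 - 1 = f s by rewrite /f expr2 invfM.
rewrite !fE (_ : f 0 = f 0 * expR (K * 0)); last by rewrite mulr0 expR0 mulr1.
apply: (@is_derive_nincry (fun s => f s * expR (K * s))
  (fun s => (K * (1 - c s ^+ 2) - 2 * k s) * c s ^- 2 * expR (K * s))) => //.
- move=> s s0; have cs := cp s (ltW s0); have cn : c s != 0 by rewrite gt_eqF.
  have dV := is_deriveV cn (dc s s0).
  have dK : is_derive s 1 (fun s => K * s) K.
    by apply: (is_derive_eq (is_deriveZ K (is_derive_id s 1))); rewrite /GRing.scale/= mulr1.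
  have dE := is_derive1_comp (is_derive_expR _) dK.
  have df := is_deriveB (is_deriveM dV dV) (is_derive_cst (1 : R) s 1).
  apply: (is_derive_eq (is_deriveM df dE)).
  rewrite !fctE /GRing.scale/= /f. by field.
- move=> s s0; rewrite -mulrA mulr_le0_ge0 ?subr_le0 ?hk//.
  by rewrite mulr_ge0 ?expR_ge0// invr_ge0 sqr_ge0.
- apply: cvgM.
    by apply: cvgB; [apply: cvgM; apply: cvgV => //; rewrite gt_eqF ?cp|exact: cvg_cst].
  apply: cvg_at_right_filter; apply: continuous_comp; last exact: continuous_expR.
  exact: mulrl_continuous.
Qed.

End HalfLine.

(** * From the vector derivative to scalar derivatives of [ip v (psi t)] *)

Section HalfLineDerivative.
Context {R : realType} {H : completeNormedModType R} {ip : H -> H -> R}.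
Context (hip : is_hilbert_ip ip).

Lemma halfline_quotient_cvg (psi : R -> H) (t : R) (d v : H) :
  halfline_derivative psi t d ->
  h^-1 * (ip v (psi (t + h)) - ip v (psi t))
    @[h --> within [set h | 0 <= t + h] (0 : R)^'] --> ip v d.
Proof.
move=> hd.
rewrite (_ : (fun h => _) = fun h => ip v (h^-1 *: (psi (t + h) - psi t))); last first.
  by apply/funext => h; rewrite (ipZr hip) (ipBr hip).
exact: (continuous_cvg _ (ip_continuous hip v d) hd).
Qed.

Lemma is_derive_ip (psi : R -> H) (t : R) (d v : H) : 0 < t ->
  halfline_derivative psi t d -> is_derive t 1 (fun s => ip v (psi s)) (ip v d).
Proof.
move=> t0 /(halfline_quotient_cvg psi t d v) hd.
pose q (h : R) := h^-1 *: (((fun s => ip v (psi s)) \o shift t) (h *: (1 : R)) - ip v (psi t)).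
suff hq : q @ (0 : R)^' --> ip v d.
  by constructor; [exact: cvgP hq|exact: (cvg_lim (@Rhausdorff R) hq)].
rewrite (_ : q = fun h => h^-1 * (ip v (psi (t + h)) - ip v (psi t))); last first.
  by apply/funext => h; rewrite /q /= /GRing.scale/= mulr1 [h + t]addrC.
move=> P /hd; rewrite /within/= => hP.
(* As [t > 0], the half-line constraint holds for all small [h], so the limit is two-sided. *)
have hS : \forall h \near (0 : R)^', 0 <= t + h.
  apply: nbhs_dnbhs; near=> h.
  rewrite addrC -lerBlDr sub0r ltW//; near: h.
  by apply: cvgr_gt; [exact: cvg_id|rewrite oppr_lt0].
by apply: filterS2 hS hP => h h0; exact.
Unshelve. all: by end_near. Qed.

Lemma halfline_right_continuous (psi : R -> H) (d v : H) :
  halfline_derivative psi 0 d ->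
  ip v (psi t) @[t --> 0^'+] --> ip v (psi 0).
Proof.
move=> /(halfline_quotient_cvg psi 0 d v) hd.
have {}hd : h^-1 * (ip v (psi h) - ip v (psi 0)) @[h --> 0^'+] --> ip v d.
  move=> P /hd hP.
  suff : \forall h \near (0 : R), 0 < h -> P (h^-1 * (ip v (psi h) - ip v (psi 0))) by [].
  have {}hP : \forall h \near (0 : R), h != 0 -> 0 <= 0 + h ->
      P (h^-1 * (ip v (psi (0 + h)) - ip v (psi 0))) by exact: hP.
  apply: filterS hP => h hP h0.
  by have := hP (lt0r_neq0 h0); rewrite add0r; apply; exact: ltW.
have h0 : (id : R -> R) h @[h --> 0^'+] --> (0 : R) by exact: cvg_at_right_filter cvg_id.
have hc : h * (h^-1 * (ip v (psi h) - ip v (psi 0))) + ip v (psi 0)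
    @[h --> 0^'+] --> 0 * ip v d + ip v (psi 0).
  by apply: cvgD; [exact: cvgM|exact: cvg_cst].
rewrite mul0r add0r in hc; apply: cvg_trans hc.
apply: near_eq_cvg; near=> h; have hn : h != 0.
  by rewrite gt_eqF//; near: h; exact: nbhs_right_gt.
by rewrite /= mulrA divff// mul1r subrK.
Unshelve. all: by end_near. Qed.

End HalfLineDerivative.

(** * Exponential convergence of the gradient flow *)

Theorem mainTheorem2 (R : realType) (H : completeNormedModType R)
  (ip : H -> H -> R) (D : set H) (A : H -> H) (E0 E1 : R) (P0 : H -> H)
  (psi0 : H) (psi dpsi : R -> H) :
  is_hilbert_ip ip ->
  lin_subspace D -> dense_in D -> linear_on D A -> self_adjoint ip D A ->
  has_inf (spec D A) -> inf (spec D A) = E0 ->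
  is_eigenvalue D A E0 ->
  has_inf (spec D A `\ E0) -> inf (spec D A `\ E0) = E1 ->
  E0 < E1 ->
  orth_proj ip (eigsp D A E0) P0 ->
  unit_sphere ip psi0 -> ~ orth ip (eigsp D A E0) psi0 ->
  (forall t, 0 <= t -> unit_sphere ip (psi t) /\ D (psi t)) ->
  (forall t, 0 <= t -> halfline_derivative psi t (dpsi t)) ->
  (forall t, 0 <= t ->
     dpsi t = - (2 : R) *: (A (psi t) - energy ip A (psi t) *: psi t)) ->
  psi 0 = psi0 ->
  let v0 := `|P0 psi0|^-1 *: P0 psi0 in
  let alpha := `|psi0 - P0 psi0| / `|P0 psi0| in
  forall t, 0 <= t ->
    `|v0 - psi t| <= Num.sqrt 2 * alpha * expR (- (2 * (E1 - E0) * t)).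
Proof.
move=> hip sD dD lA sA [specne speclb] infE0 evE0 [specne1 speclb1] infE1 E01 projP
  hpsi0 npsi0 psiS dpsiE dpsieq psi00.
have resl l : l < E0 -> resolvent D A l.
  move=> lE; apply: contrapT => nres; move: lE; rewrite ltNge => /negP; apply.
  by rewrite -infE0; exact: ge_inf.
have resr l : E0 < l < E1 -> resolvent D A l.
  move=> /andP[El lE]; apply: contrapT => nres; move: lE; rewrite ltNge => /negP; apply.
  rewrite -infE1; apply: ge_inf => //; split=> //= lE0.
  by move: El; rewrite lE0 ltxx.
have VP x : eigsp D A E0 (P0 x) by case: (projP x).
have VB x : eigsp D A E0 x -> opshift A E0 x = 0.
  by move=> [_ Ax]; rewrite shiftE Ax subrr.
have projV x v : eigsp D A E0 v -> ip v x = ip v (P0 x).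
  move=> Vv; apply/eqP; rewrite -subr_eq0 -(ipBr hip) (ipC hip).
  by case: (projP x) => _ ->.
set p0 := P0 psi0.
have p0n : p0 != 0.
  apply/eqP => p00; apply: npsi0 => v Vv.
  by rewrite (ipC hip) (projV _ _ Vv) -/p0 p00 (ip0r hip).
have np0 : 0 < `|p0| by rewrite normr_gt0.
have p0i : `|p0| != 0 by rewrite gt_eqF.
move=> v0 alpha t t0.
have Vv0 : eigsp D A E0 v0.
  have [Dp Ap] := VP psi0; split; first exact: (domZ sD).
  have := shiftZ sD lA E0 `|p0|^-1 _ Dp; rewrite (VB (P0 _))// scaler0 shiftE => /eqP.
  by rewrite subr_eq0 => /eqP.
have v01 : ip v0 v0 = 1.
  by rewrite /v0 !(ipE hip) (ipxx hip) expr2 mulKf// mulVf.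
pose k s := 2 * (energy ip A (psi s) - E0).
have dip v (s : R) : eigsp D A E0 v -> 0 < s ->
    is_derive s 1 (fun s => ip v (psi s)) (k s * ip v (psi s)).
  move=> Vv s0; have s0' := ltW s0.
  have := is_derive_ip hip psi s _ v s0 (dpsiE _ s0').
  suff -> : ip v (dpsi s) = k s * ip v (psi s) by [].
  have [_ Ds] := psiS _ s0'; have [Dv Av] := Vv.
  by rewrite dpsieq// !(ipE hip) -(proj2 sA)// Av (ipZl hip) /k; ring.
have cip v : ip v (psi s) @[s --> 0^'+] --> ip v (psi 0).
  exact: (halfline_right_continuous hip psi (dpsi 0) v (dpsiE _ (lexx 0))).
have kE (s : R) : 0 <= s -> k s = 2 * ip (opshift A E0 (psi s)) (psi s).
  move=> s0; have [ps Ds] := psiS _ s0; rewrite /k /energy ps divr1.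
  by rewrite shiftE !(ipE hip) ps mulr1 (ipC hip (psi s)).
have k0 (s : R) : 0 < s -> 0 <= k s.
  move=> s0; have [_ Ds] := psiS _ (ltW s0); rewrite (kE _ (ltW s0)) mulr_ge0//.
  exact: (form_ge0 hip sD lA sA _ resl _ Ds).
pose c s := ip v0 (psi s).
have c0E : c 0 = `|p0|.
  by rewrite /c psi00 (projV _ _ Vv0) -/p0 (ipZl hip) (ipxx hip) expr2 mulKf.
have c0p : 0 < c 0 by rewrite c0E.
have dc (s : R) : 0 < s -> is_derive s 1 c (k s * c s) by exact: dip.
have cp (s : R) : 0 <= s -> 0 < c s.
  exact: (linear_ode_gt0 dc (cip v0) c0p k0).
(* The defect [u] lies in the eigenspace and is orthogonal to [v0]. With [u] fixed, [ip u (psi t)]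
   solves the equation of [c] and starts at 0, so it is at most 0 at [t = s], where it equals
   [|u|^2]. *)
have Pc (s : R) : 0 <= s -> P0 (psi s) = c s *: v0.
  move=> s0; pose u := P0 (psi s) - c s *: v0.
  have Vu : eigsp D A E0 u.
    have [[D1 A1] [D2 A2]] := (VP (psi s), Vv0).
    have D3 : D (c s *: v0) by exact: (domZ sD).
    split; first exact: (domB sD).
    have := shiftB lA E0 _ _ D1 D3; rewrite (shiftZ sD lA)//.
    rewrite (VB v0)// (VB (P0 _))// scaler0 subr0.
    by rewrite shiftE => /eqP; rewrite subr_eq0 => /eqP.
  have uv0 : ip u v0 = 0.
    by rewrite /u (ipBl hip) (ipZl hip) v01 mulr1 (ipC hip) -projV// subrr.
  have u0 : ip u (psi 0) = 0.
    rewrite psi00 projV// -/p0.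
    have -> : p0 = `|p0| *: v0 by rewrite /v0 scalerA mulfV// scale1r.
    by rewrite (ipZr hip) uv0 mulr0.
  have := linear_ode_ratio dc (cip v0) cp (fun s => ip u (psi s))
    (fun s => dip u s Vu) (cip u) s s0.
  rewrite u0 mul0r ler_pdivrMr ?cp// mul0r projV//.
  have -> : P0 (psi s) = u + c s *: v0 by rewrite subrK.
  rewrite (ipDr hip) (ipZr hip) uv0 mulr0 addr0 => uu.
  have : u = 0 by apply: (ip_eq0 hip); apply/eqP; rewrite eq_le uu (ip_ge0 hip).
  by move=> ->; rewrite add0r.
(* The spectral gap is applied to [q = psi s - P0 (psi s)], which has [|q|^2 = 1 - c s ^+ 2] and the
   same [B]-form as [psi s]. *)
have gap (s : R) : 0 < s -> 4 * (E1 - E0) * (1 - c s ^+ 2) <= 2 * k s.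
  move=> /ltW s0; have [ps Ds] := psiS _ s0.
  have [DP AP] := VP (psi s).
  set q := psi s - P0 (psi s).
  have Dq : D q by exact: (domB sD).
  have Vq : orth ip (eigsp D A E0) q by case: (projP (psi s)).
  have := spectral_gap hip sD lA sA E01 resl resr q dD Dq Vq.
  have Bq : opshift A E0 q = opshift A E0 (psi s).
    by rewrite (shiftB lA)// (VB (P0 _))// subr0.
  have -> : ip (opshift A E0 q) q = ip (opshift A E0 (psi s)) (psi s).
    rewrite Bq /q (ipBr hip) [X in _ - X](shift_sym hip sA)// (VB (P0 _))//.
    by rewrite (ip0r hip) subr0.
  have -> : ip q q = 1 - c s ^+ 2.
    rewrite {2}/q (ipBr hip) (Vq _ (VP _)) subr0 /q (ipBl hip) ps Pc//.
    by rewrite (ipZl hip) expr2.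
  by rewrite kE//; lra.
have decay := bernoulli_decay dc (cip v0) cp _ gap t t0.
have ct := cp _ t0; have [pt _] := psiS _ t0.
have c1 : c t <= 1.
  rewrite (le_trans (ler_norm _))// (le_trans (cauchy_schwarz hip _ _))//.
  by rewrite !(ip_norm hip) v01 pt sqrtr1 mulr1.
(* Pythagoras: [|psi0 - p0|^2 = 1 - |p0|^2]. *)
have alphaE : c 0 ^- 2 - 1 = alpha ^+ 2.
  rewrite c0E /alpha expr_div_n -!(ipxx hip) (ipBr hip).
  have [_ hq] := projP psi0.
  rewrite (hq p0) ?subr0 ?(ipBl hip) ?[ip psi0 psi0]hpsi0; last exact: VP.
  rewrite (projV psi0 p0 (VP psi0)) -/p0 (ipxx hip).
  by field.
have alpha0 : 0 <= alpha by rewrite divr_ge0.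
clearbody alpha v0.
rewrite -ler_sqr ?nnegrE// ?mulr_ge0 ?sqrtr_ge0 ?expR_ge0//.
rewrite -(ipxx hip) !exprMn sqr_sqrtr// -alphaE !(ipE hip) v01 pt (ipC hip (psi t)) -/(c t).
have -> : expR (- (2 * (E1 - E0) * t)) ^+ 2 = expR (- (4 * (E1 - E0) * t)).
  by rewrite expr2 -expRD; congr expR; ring.
have : c t ^- 2 - 1 <= (c 0 ^- 2 - 1) * expR (- (4 * (E1 - E0) * t)).
  by rewrite expRN ler_pdivlMr ?expR_gt0.
suff : 1 - c t <= c t ^- 2 - 1 by lra.
have ct2 : 0 < c t ^+ 2 by rewrite exprn_gt0.
rewrite -(ler_pM2r ct2) [leRHS]mulrBl mulVf ?gt_eqF// mul1r.
(* This product is [(1 - c^2) - c^2 (1 - c)], the difference of the two sides after multiplication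
   by [c^2]. *)
have : 0 <= (1 - c t) * (1 + c t - c t ^+ 2).
  rewrite mulr_ge0 ?subr_ge0//.
  have : c t ^+ 2 <= 1 by rewrite expr_le1// ltW.
  by lra.
by lra.
Qed.
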